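(* For any $u_h\in V_p$ there exists a collection of functions $\{\boldsymbol g_j(u_h)\}_{j=1}^{n_G}\subset \boldsymbol V_{p-1}^d$, $n_G:=\dim(\boldsymbol V_{p-1}^d)$, such that $$\sum_{j=1}^{n_G}(\boldsymbol g_j(u_h),G_hv_{1,h})\,(\boldsymbol g_j(u_h),G_hv_{2,h})=(u_h^+,\,G_hv_{1,h}\cdot G_hv_{2,h})$$ for any $v_{1,h},v_{2,h}\in V_p$. The functions $\boldsymbol g_j$ are given by $$\boldsymbol g_j(u_h):=\sum_{i=1}^{n_G}\big(M_{\mathrm G}^{-1}R(u_h)\big)_{ij}\,\boldsymbol f_i,$$ where $\{\boldsymbol f_i\}_{i=1}^{n_G}$ is a basis of $\boldsymbol V_{p-1}^d$, $M_{\mathrm G}$ is the mass matrix with entries $(M_{\mathrm G})_{ij}=(\boldsymbol f_i,\boldsymbol f_j)$, and $R(u_h)$ is the unique symmetric positive semi-definite square root of the symmetric positive semi-definite matrix $P(u_h)$ with entries $$P(u_h)_{ij}:=\int_{\mathbb T^d}u_h^+\,\boldsymbol f_i\cdot\boldsymbol f_j\,\mathrm d\boldsymbol x .$$ Moreover, for each $j$ the map $u_h\mapsto \boldsymbol g_j(u_h)$ is continuous from $V_p$ to $\boldsymbol V_{p-1}^d$.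
   Context: Let $d\in\{1,2,3\}$, $p\ge1$ an integer, and $\mathbb T^d$ the $d$-dimensional flat torus; $(\cdot,\cdot)$ is the $L^2(\mathbb T^d)$ inner product (scalar- or $\mathbb R^d$-valued). $\mathcal T_h$ is a shape-regular, quasi-uniform affine simplicial mesh of $\mathbb T^d$, and $\mathcal F_h$ is the set of its facets (by periodicity, every facet is shared by two elements). $V_p:=\{u\in L^2(\mathbb T^d): u|_K\in P_p(K)\ \forall K\in\mathcal T_h\}$ and $\boldsymbol V_\ell^d:=\{\boldsymbol v\in L^2(\mathbb T^d;\mathbb R^d): \boldsymbol v|_K\in [P_\ell(K)]^d\ \forall K\in\mathcal T_h\}$, where $P_\ell(K)$ denotes polynomials of degree at most $\ell$ on $K$ (no continuity across facets is imposed). For a facet $F=\partial K_\ell\cap\partial K_r$ with outward unit normals $\boldsymbol n_{K_\ell}=-\boldsymbol n_{K_r}$, the average is $\{\!\{\boldsymbol v\}\!\}:=\tfrac12(\boldsymbol v|_{K_\ell}+\boldsymbol v|_{K_r})$ and the jump of a scalar function is $[\![v]\!]:=v|_{K_\ell}\boldsymbol n_{K_\ell}+v|_{K_r}\boldsymbol n_{K_r}$. The local lifting $\boldsymbol{\mathcal L}_F:L^2(F;\mathbb R^d)\to\boldsymbol V_{p-1}^d$ is defined by $\int_{\mathbb T^d}\boldsymbol{\mathcal L}_F(\boldsymbol u)\cdot\boldsymbol v_h\,\mathrm d\boldsymbol x=\int_F\{\!\{\boldsymbol v_h\}\!\}\cdot\boldsymbol u\,\mathrm dS$ for all $\boldsymbol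 v_h\in\boldsymbol V_{p-1}^d$. The discrete gradient of $v_h\in V_p$ is $G_hv_h:=\nabla_hv_h-\sum_{F\in\mathcal F_h}\boldsymbol{\mathcal L}_F([\![v_h]\!])$, where $\nabla_h$ is the elementwise gradient. The positive part is $u_h^+:=\max\{u_h,0\}$ (taken elementwise). *)

(* Defs.v *)
From HB Require Import structures.
From mathcomp Require Import all_boot all_order all_algebra.
(* Without its notations, which clash with those of MathComp-Analysis. *)
From mathcomp Require mpoly.
Import -(notations) mpoly.
From mathcomp Require Import all_classical all_reals all_analysis.

Set Implicit Arguments.
Unset Strict Implicit.
Unset Printing Implicit Defensive.

Import Order.TTheory GRing.Theory Num.Theory.
Import numFieldNormedType.Exports.

Local Open Scope classical_set_scope.
Local Open Scope ring_scope.

Section lebesgue_Rn.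
Context {R : realType}.

Notation borel := (measurableTypeR R).

Definition tcons n (x : borel * n.-tuple borel) : n.+1.-tuple borel :=
  [tuple of x.1 :: x.2].

Lemma measurable_tcons n : measurable_fun setT (@tcons n).
Proof. by apply: measurable_cons. Qed.

Lemma tcons_preimage n A : measurable A -> measurable (@tcons n @^-1` A).
Proof.
by move=> mA; rewrite -[X in measurable X]setTI; exact: measurable_tcons.
Qed.

Section succ.
Variables (n : nat) (m : {sigma_finite_measure set (n.-tuple borel) -> \bar R}).

Definition lebesgue_succ : set (n.+1.-tuple borel) -> \bar R :=
  pushforward (@lebesgue_measure R \x m)%E (@tcons n).

Let lebesgue_succ0 : lebesgue_succ set0 = 0%E.
Proof. by rewrite /lebesgue_succ /pushforward preimage_set0 measure0. Qed.

Let lebesgue_succ_ge0 A : (0 <= lebesgue_succ A)%E.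
Proof. by rewrite /lebesgue_succ /pushforward measure_ge0. Qed.

Let lebesgue_succ_sigma_additive : semi_sigma_additive lebesgue_succ.
Proof.
move=> F mF tF mUF; rewrite /lebesgue_succ /pushforward preimage_bigcup.
apply: measure_semi_sigma_additive.
- by move=> k; exact: tcons_preimage.
- apply/trivIsetP => i j _ _ ij; rewrite -preimage_setI.
  by move/trivIsetP : tF => /(_ _ _ _ _ ij) ->//; rewrite preimage_set0.
- by rewrite -preimage_bigcup; exact: tcons_preimage.
Qed.

HB.instance Definition _ := isMeasure.Build _ _ _ lebesgue_succ
  lebesgue_succ0 lebesgue_succ_ge0 lebesgue_succ_sigma_additive.

Let lebesgue_succ_sigma_finite : sigma_finite setT lebesgue_succ.
Proof.
have /sigma_finiteP[F [UF ndF Foo]] := sigma_finiteT (@lebesgue_measure R).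
have /sigma_finiteP[G [UG ndG Goo]] := sigma_finiteT m.
exists (fun k => [set t | F k (thead t) /\ G k [tuple of behead t]]).
  apply/seteqP; split=> // t _.
  have [i _ Fi] : (\bigcup_i F i) (thead t) by rewrite -UF.
  have [j _ Gj] : (\bigcup_i G i) [tuple of behead t] by rewrite -UG.
  exists (maxn i j) => //; split.
    by move: (thead t) Fi; exact/subsetPset/ndF/leq_maxl.
  by move: [tuple of behead t] Gj; exact/subsetPset/ndG/leq_maxr.
move=> k; have [mF oF] := Foo k; have [mG oG] := Goo k; split.
  apply: measurableI.
    by rewrite -[X in measurable X]setTI; exact: measurable_tnth.
  by rewrite -[X in measurable X]setTI; exact: measurable_behead.
rewrite /lebesgue_succ /pushforward.
have -> : @tcons n @^-1` [set t | F k (thead t) /\ G k [tuple of behead t]] =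
    F k `*` G k.
  apply/seteqP; split=> -[x t].
    move=> [/= Fx]; rewrite (_ : [tuple of _] = t)//; exact: val_inj.
  move=> [/= Fx Gt]; split=> //=.
  by rewrite (_ : [tuple of _] = t)//; exact: val_inj.
by rewrite product_measure1E// lte_mul_pinfty// ge0_fin_numE.
Qed.

HB.instance Definition _ := Measure_isSigmaFinite.Build _ _ _ lebesgue_succ
  lebesgue_succ_sigma_finite.

End succ.

Fixpoint lebesgue_Rn n : {sigma_finite_measure set (n.-tuple borel) -> \bar R} :=
  if n is k.+1 return {sigma_finite_measure set (n.-tuple borel) -> \bar R}
  then lebesgue_succ (lebesgue_Rn k)
  else \d_([tuple] : 0.-tuple borel).
End lebesgue_Rn.

Section polyn.
Variables (R : realType) (d l : nat).

(* [msize q] is the total degree of [q] plus one, and [0] if [q = 0]. *)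
Definition deg_le : {pred mpoly d R} := [pred q | (mpoly.msize q <= l.+1)%N].

Lemma deg_leP (q : mpoly d R) :
  reflect (forall m, (l < mdeg m)%N -> mcoeff m q = 0) (q \in deg_le).
Proof.
rewrite inE /=; apply: (iffP idP) => [ql m lm|q0].
  by apply/memN_msupp_eq0/msize_mdeg_ge/(leq_trans ql).
rewrite msizeE; apply/bigmax_leqP_seq => m + _; rewrite mcoeff_msupp ltnS.
by apply: contraNT; rewrite -ltnNge => /q0 ->.
Qed.

Lemma deg_le_submod_closed : submod_closed deg_le.
Proof.
split=> [|a p q /deg_leP p0 /deg_leP q0]; apply/deg_leP => m lm.
  by rewrite mcoeff0.
by rewrite mcoeffD mcoeffZ p0// q0// mulr0 addr0.
Qed.

HB.instance Definition _ :=
  GRing.isSubmodClosed.Build R (mpoly d R) deg_le deg_le_submod_closed.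

Record polyn := Polyn { polyn_val :> mpoly d R ; _ : polyn_val \in deg_le }.

HB.instance Definition _ := [isSub for polyn_val].
HB.instance Definition _ := [Choice of polyn by <:].
HB.instance Definition _ := [SubChoice_isSubLmodule of polyn by <:].

Let mono := bmultinom d l.+1.

Lemma polyn_vector_axiom : Vector.axiom #|{: mono}| polyn.
Proof.
pose v2r (q : polyn) : 'rV[R]_#|{: mono}| :=
  \row_i mcoeff (bmnm (enum_val i)) (polyn_val q).
pose r2m (v : 'rV[R]_#|{: mono}|) : mpoly d R :=
  \sum_i v 0 i *: mpolyX R (bmnm (enum_val i)).
have r2mE v m : mcoeff m (r2m v) =
    \sum_i v 0 i * (bmnm (enum_val i : mono) == m)%:R.
  by rewrite /r2m raddf_sum; apply: eq_bigr => i _ /=; rewrite mcoeffZ mcoeffX.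
have r2m_le v : r2m v \in deg_le.
  apply/deg_leP => m lm; rewrite r2mE big1// => i _.
  case: eqP => [im|_]; last by rewrite mulr0.
  by have := bmdeg (enum_val i : mono); rewrite im ltnS leqNgt lm.
exists v2r.
  by move=> a p q; apply/rowP => i; rewrite !mxE /= mcoeffD mcoeffZ.
exists (fun v => Polyn (r2m_le v)) => [q|v].
  apply/val_inj/mpolyP => m /=; rewrite r2mE.
  have [lm|ml] := ltnP l (mdeg m).
    rewrite (deg_leP _ (valP q) m lm) big1// => i _.
    case: eqP => [im|_]; last by rewrite mulr0.
    by have := bmdeg (enum_val i : mono); rewrite im ltnS leqNgt lm.
  have ml' : (mdeg m < l.+1)%N by [].
  rewrite (bigD1 (enum_rank (BMultinom ml' : mono)))//= mxE enum_rankK eqxx.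
  rewrite mulr1 big1 ?addr0// => i /negP im; case: eqP => [eim|]; last first.
    by rewrite mulr0.
  by case: im; apply/eqP/(can_inj enum_valK)/val_inj; rewrite /= enum_rankK.
apply/rowP => i; rewrite mxE /= r2mE (bigD1 i)//= eqxx mulr1 big1 ?addr0//.
move=> j /negP ji; case: eqP => [eji|]; last by rewrite mulr0.
by case: ji; apply/eqP/(can_inj enum_valK)/val_inj.
Qed.

HB.instance Definition _ := Lmodule_hasFinDim.Build R polyn polyn_vector_axiom.

Definition peval (q : polyn) (x : 'rV[R]_d) : R := meval (x 0) (polyn_val q).

End polyn.

Lemma deg_le_deriv (R : realType) d l (i : 'I_d) (q : polyn R d l) :
  mderiv i (polyn_val q) \in @deg_le R d l.-1.
Proof.
apply/deg_leP => m lm; rewrite mcoeff_deriv (deg_leP _ _ (valP q)) ?mul0rn//.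
by rewrite mdegD mdeg1 addn1; case: l q lm => [|l] q //=.
Qed.

Definition pderiv (R : realType) d l (i : 'I_d) (q : polyn R d l) :
  polyn R d l.-1 := Polyn (deg_le_deriv i q).

Section geometry.
Context {R : realType}.
Implicit Types d k : nat.

Definition dot d (x y : 'rV[R]_d) : R := \sum_i x 0 i * y 0 i.
Definition enorm d (x : 'rV[R]_d) : R := Num.sqrt (dot x x).
Definition diam d (S : set 'rV[R]_d) : R :=
  sup [set r | exists x y, [/\ S x, S y & r = enorm (x - y)]].
Definition inradius d (S : set 'rV[R]_d) : R :=
  sup [set r | 0 <= r /\ exists c, [set x | enorm (x - c) <= r] `<=` S].

Definition lattice d (z : 'rV[R]_d) : Prop := forall i, z 0 i \is a Num.int.
Definition translate d (z : 'rV[R]_d) (S : set 'rV[R]_d) : set 'rV[R]_d :=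
  [set x | S (x - z)].

(* Barycentric coordinates vanish off A; the face of A = set0 is empty. *)
Definition face d k (w : 'I_k -> 'rV[R]_d) (A : {set 'I_k}) : set 'rV[R]_d :=
  [set x | exists c : 'I_k -> R,
    [/\ forall i, 0 <= c i, forall i, i \notin A -> c i = 0,
        \sum_i c i = 1 & x = \sum_i c i *: w i]].
Definition simplex d k (w : 'I_k -> 'rV[R]_d) : set 'rV[R]_d :=
  face w [set: 'I_k]%SET.
Definition open_simplex d k (w : 'I_k -> 'rV[R]_d) : set 'rV[R]_d :=
  [set x | exists c : 'I_k -> R,
    [/\ forall i, 0 < c i, \sum_i c i = 1 & x = \sum_i c i *: w i]].

Definition edge_mx d k (w : 'I_k.+1 -> 'rV[R]_d) : 'M[R]_(k, d) :=
  \matrix_(i < k) (w (lift ord0 i) - w ord0).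

Definition rV_of_tuple k (t : k.-tuple (measurableTypeR R)) : 'rV[R]_k :=
  \row_i (tnth t i : R).

(* Surface integral over the k-simplex with vertices w, through its affine
   parametrization by the reference simplex; for k = 0 it is a point value. *)
Definition simplex_int d k (w : 'I_k.+1 -> 'rV[R]_d) (g : 'rV[R]_d -> R) : R :=
  Num.sqrt (\det (edge_mx w *m (edge_mx w)^T)) *
  Rintegral (@lebesgue_Rn R k)
    [set t | (forall i, 0 <= (tnth t i : R)) /\ \sum_i (tnth t i : R) <= 1]
    (fun t => g (w ord0 + rV_of_tuple t *m edge_mx w)).

(* The torus is R^d / Z^d; functions on it are Z^d-periodic functions on R^d,
   integrated over a fundamental cell. *)
Definition torus_int d (g : 'rV[R]_d -> R) : R :=
  Rintegral (@lebesgue_Rn R d) [set t | forall i, 0 <= (tnth t i : R) < 1]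
    (fun t => g (rV_of_tuple t)).

End geometry.

Record mesh (R : realType) (d : nat) := Mesh {
  nelt : nat;
  (* Vertices in R^d of one lift of each element. *)
  vertex : 'I_nelt -> 'I_d.+1 -> 'rV[R]_d;
  mesh_nondegenerate : forall K, row_free (edge_mx (vertex K));
  mesh_embedded : forall K z, lattice z -> z != 0 ->
    simplex (vertex K) `&` translate z (simplex (vertex K)) = set0;
  mesh_cover : forall x, exists K z,
    lattice z /\ translate z (simplex (vertex K)) x;
  mesh_conforming : forall K K' z, lattice z -> K != K' ->
    exists A A' : {set 'I_d.+1},
      [/\ (#|A| < d.+1)%N, (#|A'| < d.+1)%N,
          simplex (vertex K) `&` translate z (simplex (vertex K'))
            = face (vertex K) A &
          simplex (vertex K) `&` translate z (simplex (vertex K'))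
            = translate z (face (vertex K') A')] }.

Arguments nelt {R d}.
Arguments vertex {R d}.

Notation elt T := 'I_(nelt T).

(* The spaces V_l and V_l^d: an element is determined, as an L^2 class, by its
   restrictions to the mesh elements, one polynomial (vector) per element. *)
Definition dg (R : realType) d (T : mesh R d) (l : nat) : Type :=
  {ffun elt T -> polyn R d l}.
HB.instance Definition _ (R : realType) d (T : mesh R d) l :=
  Vector.copy (dg T l) {ffun elt T -> polyn R d l}.

Definition dgv (R : realType) d (T : mesh R d) (l : nat) : Type :=
  {ffun elt T -> {ffun 'I_d -> polyn R d l}}.
HB.instance Definition _ (R : realType) d (T : mesh R d) l :=
  Vector.copy (dgv T l) {ffun elt T -> {ffun 'I_d -> polyn R d l}}.

Section dg.
Context {R : realType} {d : nat} (T : mesh R d).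
Implicit Types (K : elt T) (x : 'rV[R]_d) (l p : nat).

Definition shape_regular (sigma : R) : Prop :=
  forall K, diam (simplex (vertex T K)) <= sigma * inradius (simplex (vertex T K)).
Definition quasi_uniform (c : R) : Prop :=
  forall K K', diam (simplex (vertex T K)) <= c * diam (simplex (vertex T K')).

(* The translate of x by the lattice that lies in the lifted closed element K
   (unique by [mesh_embedded]); junk if there is none. *)
Definition lift_to K x : 'rV[R]_d :=
  xget x [set y | simplex (vertex T K) y /\ lattice (y - x)].

(* u|_K as a function on the closed element K of the torus. *)
Definition restr l (u : dg T l) K x : R := peval (u K) (lift_to K x).

Definition elt_interior K : set 'rV[R]_d :=
  [set x | exists2 y, open_simplex (vertex T K) y & lattice (y - x)].

(* The periodic function represented by u: the open elements are disjoint in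
   the torus and cover it up to a null set, where the value is 0. *)
Definition dg_fun l (u : dg T l) x : R :=
  \sum_K \1_(elt_interior K) x * restr u K x.

Definition dgv_comp l (v : dgv T l) (i : 'I_d) : dg T l := [ffun K => v K i].
Definition vrestr l (v : dgv T l) K x : 'rV[R]_d :=
  \row_i restr (dgv_comp v i) K x.
Definition dgv_fun l (v : dgv T l) x : 'rV[R]_d := \row_i dg_fun (dgv_comp v i) x.

Definition ip l (v w : dgv T l) : R :=
  torus_int (fun x => dot (dgv_fun v x) (dgv_fun w x)).
Definition pos_part_fun l (u : dg T l) x : R := Num.max (dg_fun u x) 0.
Definition L2norm l (u : dg T l) : R :=
  Num.sqrt (torus_int (fun x => dg_fun u x ^+ 2)).
Definition L2normv l (v : dgv T l) : R := Num.sqrt (ip v v).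

(* A side (K, i) is the facet of K opposite to its i-th vertex. A facet of the
   mesh is the set of the sides that coincide in the torus: as the torus has no
   boundary and by conformity, there are exactly two, in distinct elements. *)
Definition side : finType := (elt T * 'I_d.+1)%type.
Definition side_set (s : side) : set 'rV[R]_d :=
  face (vertex T s.1) (~: [set s.2])%SET.
Definition same_facet (s s' : side) : bool :=
  `[< exists2 z, lattice z & side_set s' = translate z (side_set s) >].
Definition facets : {set {set side}} :=
  equivalence_partition same_facet [set: side]%SET.

Definition side_vertex (s : side) (j : 'I_d.-1.+1) : 'rV[R]_d :=
  vertex T s.1 (inord (bump s.2 j)).

Definition normal (s : side) : 'rV[R]_d :=
  xget 0 [set n : 'rV[R]_d |
    [/\ dot n n = 1,
        forall j, dot n (side_vertex s j - side_vertex s ord0) = 0 &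
        dot n (vertex T s.1 s.2 - side_vertex s ord0) < 0]].

(* Any side parametrizes the facet, the integrand being periodic. *)
Definition facet_int (F : {set side}) (g : 'rV[R]_d -> R) : R :=
  if [pick s in F] is Some s then simplex_int (side_vertex s) g else 0.

Definition avg l (v : dgv T l) (F : {set side}) x : 'rV[R]_d :=
  2^-1 *: \sum_(s in F) vrestr v s.1 x.
Definition jump l (u : dg T l) (F : {set side}) x : 'rV[R]_d :=
  \sum_(s in F) restr u s.1 x *: normal s.

Definition is_lifting l (F : {set side}) (u : 'rV[R]_d -> 'rV[R]_d)
    (L : dgv T l) : Prop :=
  forall v : dgv T l, ip L v = facet_int F (fun x => dot (avg v F x) (u x)).
(* The representative exists and is unique: [ip] is an inner product on the
   finite-dimensional space [dgv T l]. *)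
Definition lifting l (F : {set side}) (u : 'rV[R]_d -> 'rV[R]_d) : dgv T l :=
  xget 0 [set L | is_lifting F u L].

Definition grad p (u : dg T p) : dgv T p.-1 :=
  [ffun K => [ffun i => pderiv i (u K)]].
Definition dgrad p (u : dg T p) : dgv T p.-1 :=
  grad u - \sum_(F in facets) lifting p.-1 F (jump u F).

End dg.

Section psd.
Context {R : realType} {n : nat}.
Implicit Types A S : 'M[R]_n.

Definition sym_psd A : Prop :=
  A^T = A /\ forall c : 'rV[R]_n, 0 <= (c *m A *m c^T) 0 0.
Definition is_psd_sqrt A S : Prop := sym_psd S /\ S *m S = A.
Definition psd_sqrt A : 'M[R]_n := xget 0 [set S | is_psd_sqrt A S].

End psd.

Section matrices.
Context {R : realType} {d : nat} (T : mesh R d) {l p n : nat}.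
Variable f : n.-tuple (dgv T l).

Definition mass_mx : 'M[R]_n := \matrix_(i, j) ip (tnth f i) (tnth f j).

Definition weighted_mx (u : dg T p) : 'M[R]_n :=
  \matrix_(i, j) torus_int (fun x =>
    pos_part_fun u x * dot (dgv_fun (tnth f i) x) (dgv_fun (tnth f j) x)).

Definition gvec (u : dg T p) (j : 'I_n) : dgv T l :=
  \sum_i (invmx mass_mx *m psd_sqrt (weighted_mx u)) i j *: tnth f i.

End matrices.

(* Main.v *)
Require Import Defs.
From HB Require Import structures.
From mathcomp Require Import all_boot all_order all_algebra.
From mathcomp Require mpoly.
Import -(notations) mpoly.
From mathcomp Require Import complex.
From mathcomp Require Import all_classical all_reals all_analysis.
From mathcomp Require Import measurable_realfun.
From mathcomp Require Import ring lra.

Set Implicit Arguments.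
Unset Strict Implicit.
Unset Printing Implicit Defensive.

Import Order.TTheory GRing.Theory Num.Theory.
Import numFieldNormedType.Exports.

Local Open Scope classical_set_scope.
Local Open Scope ring_scope.

(** The identity is linear algebra in the finite-dimensional space of
piecewise polynomial fields, in which every discrete gradient lies. Let M be
the mass matrix, P the matrix weighted by the positive part of u and R its
square root. If G has coordinates a in the basis f, then (g_j, G) is the j-th
entry of (M^-1 R)^T M a = R a ([gvec_ip]). Summing over j the products of such
entries for two fields with coordinates a and b gives a^T R R b = a^T P b, and
this is the weighted inner product of the two fields ([sum_gvec_ip]).

The integrals behave as expected because a discontinuous piecewise polynomial
is bounded and measurable on the torus ([bounded_measurable_dg_fun]). The
matrix M is invertible because the inner product is definite ([ip_gt0]): the
interiors of distinct elements are disjoint in the torus, so on the interior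
of an element K the function is the polynomial attached to K; if that
polynomial is nonzero, it is bounded away from 0 on a small box inside K, and
this box has positive measure ([dg_positive_box]).

Square roots of symmetric positive semidefinite matrices exist by the real
spectral theorem ([spectral]). Their uniqueness and their continuous dependence
on the matrix both follow from one estimate in the style of Powers and Stormer:
the entries of S - T are bounded by a multiple of the square root of the largest
entry of S^2 - T^2 ([psd_sqrt_holder]). As the positive part is 1-Lipschitz, P(u)
is Lipschitz in u for the L^1 norm ([weighted_mx_lipschitz]), which the L^2 norm
controls on a space of measure one ([torus_int_norm_le]). Finally the squared
norm of g_j(w) - g_j(u) is the j-th diagonal entry of D M^-1 D, where D is the
difference of the two square roots ([gvec_sub_ip]), so continuity of g_j follows
from that of the square root ([gvec_continuous]). *)

(** * The real spectral theorem and square roots of matrices *)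

Section spectral.
Context {R : realType}.

Lemma mul_rV_cV n (x y : 'rV[R]_n) : (x *m y^T) 0 0 = dot x y.
Proof. by rewrite mxE; apply: eq_bigr => i _; rewrite mxE. Qed.

Lemma dotC n (x y : 'rV[R]_n) : dot x y = dot y x.
Proof. by apply: eq_bigr => i _; rewrite mulrC. Qed.

Lemma dot_eq0 n (x : 'rV[R]_n) : dot x x = 0 -> x = 0.
Proof.
move=> /eqP; rewrite psumr_eq0 => [/allP x0|i _]; last by rewrite -expr2 sqr_ge0.
apply/rowP => i; rewrite mxE; apply/eqP.
by have := x0 i (mem_index_enum i); rewrite -expr2 sqrf_eq0.
Qed.

Lemma dot_ge0 n (x : 'rV[R]_n) : 0 <= dot x x.
Proof. by apply: sumr_ge0 => i _; rewrite -expr2 sqr_ge0. Qed.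

(** The characteristic polynomial has a complex root a + i b, with a complex
eigenvector x + i y. Computing (x A) . y = x . (y A) in two ways gives
b (|x|^2 + |y|^2) = 0, so b = 0 and one of x, y is a real eigenvector. *)
Lemma symmetric_eigenvector n (A : 'M[R]_n.+1) : A^T = A ->
  exists a (v : 'rV_n.+1), v != 0 /\ v *m A = a *: v.
Proof.
move=> As; pose Ac := map_mx (real_complex R) A.
have [l rl] : exists l, root (char_poly Ac) l.
  by apply/closed_rootP; rewrite size_char_poly.
have /eigenvalueP[w wA w0] : eigenvalue Ac l by rewrite eigenvalue_root_char.
pose x : 'rV[R]_n.+1 := \row_j complex.Re (w 0 j).
pose y : 'rV[R]_n.+1 := \row_j complex.Im (w 0 j).
have sumC (F : 'I_n.+1 -> R[i]) : \sum_i F i =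
    Complex (\sum_i complex.Re (F i)) (\sum_i complex.Im (F i)).
  apply: (big_ind3 (fun z a b => z = Complex a b)) => //.
    by move=> z a b z' a' b' -> ->.
  by move=> i _; case: (F i).
have wAj j : Complex ((x *m A) 0 j) ((y *m A) 0 j) = l * w 0 j.
  have := congr1 (fun M : 'rV_n.+1 => M 0 j) wA; rewrite !mxE => <-.
  rewrite sumC; congr Complex; apply: eq_bigr => k _; rewrite !mxE;
    by case: (w 0 k) => a b /=; ring.
case: l {rl} wA wAj => a b wA wAj.
have xA : x *m A = a *: x - b *: y.
  by apply/rowP => j; have := wAj j; rewrite !mxE; case: (w 0 j) => c e [-> _].
have yA : y *m A = a *: y + b *: x.
  apply/rowP => j; have := wAj j; rewrite !mxE; case: (w 0 j) => c e [_ ->] /=.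
  by rewrite mulrC.
have dotZl c (s t : 'rV[R]_n.+1) : dot (c *: s) t = c * dot s t.
  by rewrite -!mul_rV_cV -scalemxAl mxE.
have dotDl (s t r : 'rV[R]_n.+1) : dot (s + t) r = dot s r + dot t r.
  by rewrite -!mul_rV_cV mulmxDl mxE.
have b0 : b * (dot x x + dot y y) = 0.
  have : dot (x *m A) y = dot (y *m A) x.
    by rewrite dotC -[LHS]mul_rV_cV -[RHS]mul_rV_cV !trmx_mul As mulmxA.
  rewrite xA yA -scaleNr !dotDl !dotZl (dotC y x) => e.
  by rewrite mulrDr; move: e; lra.
have xy0 : (x != 0) || (y != 0).
  apply: contraNT w0; rewrite negb_or !negbK => /andP[/eqP x0 /eqP y0].
  apply/eqP/rowP => j; rewrite mxE.
  have := congr1 (fun M : 'rV[R]_n.+1 => M 0 j) x0.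
  have := congr1 (fun M : 'rV[R]_n.+1 => M 0 j) y0.
  by rewrite !mxE; case: (w 0 j) => c e /= -> ->.
have {}b0 : b = 0.
  move/eqP: b0; rewrite mulf_eq0 paddr_eq0 ?dot_ge0//.
  case/orP => [/eqP//|/andP[/eqP/dot_eq0 x0 /eqP/dot_eq0 y0]].
  by move: xy0; rewrite x0 y0 eqxx.
move: xA yA; rewrite b0 !scale0r subr0 addr0 => xA yA.
by case/orP: xy0 => nz; exists a; [exists x|exists y].
Qed.

(** The reflection in the hyperplane orthogonal to u - e_0 exchanges the unit
vectors e_0 and u when they differ. It completes u to an orthonormal basis. *)
Lemma householder n (u : 'rV[R]_n.+1) : dot u u = 1 ->
  exists Q : 'M[R]_n.+1, [/\ Q^T = Q, Q *m Q = 1%:M & delta_mx 0 0 *m Q = u].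
Proof.
move=> u1; pose e : 'rV[R]_n.+1 := delta_mx 0 0; rewrite -/e.
have [->|ue] := eqVneq u e.
  by exists 1%:M; rewrite trmx1 !mulmx1.
pose w := u - e.
have w0 : dot w w != 0.
  by apply: contra_neq ue => /dot_eq0/eqP; rewrite subr_eq0 => /eqP.
have ee : dot e e = 1.
  rewrite /dot (bigD1 0)//= !mxE eqxx mulr1 big1 ?addr0// => i i0.
  by rewrite !mxE (negbTE i0) mulr0.
have wE : dot w w = - (2 * dot e w).
  rewrite /w -!mul_rV_cV linearB /= mulmxBl !mulmxBr !mxE.
  have := mul_rV_cV u u; have := mul_rV_cV e e; have := mul_rV_cV e u.
  have := mul_rV_cV u e; rewrite !mxE u1 ee (dotC u e) => -> -> -> ->.
  by ring.
pose c := 2 / dot w w.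
have wwE : w *m w^T = (dot w w)%:M.
  by rewrite [LHS]mx11_scalar mul_rV_cV.
pose N := w^T *m w.
have NN : N *m N = dot w w *: N.
  by rewrite /N mulmxA -(mulmxA w^T) wwE mul_mx_scalar scalemxAl.
have eN : c *: (e *m N) = - w.
  rewrite /N mulmxA [e *m w^T]mx11_scalar mul_rV_cV mul_scalar_mx scalerA.
  rewrite -scaleN1r; congr (_ *: _).
  (* As u and e are unit vectors, |w|^2 = - 2 (e . w). *)
  have e2 : dot e w = - dot w w / 2 by rewrite wE; field.
  by rewrite /c e2; field.
have Ns : N^T = N by rewrite /N trmx_mul trmxK.
exists (1%:M - c *: N); move: N NN eN Ns => N NN eN Ns; split.
- by rewrite linearB /= trmx1 linearZ /= Ns.
- rewrite mulmxBl mul1mx mulmxBr mulmx1 -scalemxAl -scalemxAr NN !scalerA.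
  have -> : c * c * dot w w = c + c by rewrite /c; field.
  by rewrite scalerDl opprB addrK subrK.
- by rewrite mulmxBr mulmx1 -scalemxAr eN opprK addrC subrK.
Qed.

(** Induction on the size: conjugating A by a reflection that sends e_0 to a unit
eigenvector makes its first row, hence by symmetry its first column, vanish
off the diagonal. *)
Lemma spectral n (A : 'M[R]_n) : A^T = A ->
  exists (P : 'M[R]_n) (D : 'rV[R]_n),
    P *m P^T = 1%:M /\ A = P^T *m diag_mx D *m P.
Proof.
elim: n => [|n IHn] in A * => As.
  by exists 1%:M, 0; split; [rewrite trmx1 mulmx1|apply/matrixP => -[]].
have [a [v [v0 vA]]] := symmetric_eigenvector As.
have vv : 0 < dot v v.
  by rewrite lt0r dot_ge0 andbT; apply: contraNneq v0 => /dot_eq0 ->.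
pose u := (Num.sqrt (dot v v))^-1 *: v.
have uA : u *m A = a *: u by rewrite -scalemxAl vA !scalerA mulrC.
have u1 : dot u u = 1.
  rewrite -mul_rV_cV linearZ /= -scalemxAl -scalemxAr scalerA mxE mul_rV_cV.
  by rewrite -invfM -expr2 sqr_sqrtr ?ltW// mulVf// gt_eqF.
have [Q [Qs QQ eQ]] := householder u1.
set e := delta_mx 0 0 in eQ.
pose B : 'M[R]_(1 + n) := Q *m A *m Q.
have Bs : B^T = B by rewrite /B !trmx_mul Qs As mulmxA.
have eB : e *m B = a *: e.
  by rewrite /B !mulmxA eQ uA -scalemxAl -eQ -mulmxA QQ mulmx1.
have AE : A = Q *m B *m Q.
  by rewrite /B !mulmxA QQ mul1mx -mulmxA QQ mulmx1.
move: B Bs eB AE => B Bs eB AE.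
have B0j j : B (lshift n 0) j = a * (j == lshift n 0)%:R.
  have := congr1 (fun M : 'rV_n.+1 => M 0 j) eB.
  by rewrite /e -rowE lshift0 !mxE eqxx /=.
have [|P' [D' [PP' BE]]] := IHn (drsubmx B).
  by rewrite trmx_drsub Bs.
have BB : B = block_mx a%:M 0 0 (drsubmx B).
  rewrite -[LHS]submxK; congr block_mx.
  - by apply/matrixP => i j; rewrite !ord1 !mxE B0j eqxx mulr1 mulr1n.
  - by apply/matrixP => i j; rewrite !ord1 !mxE B0j eq_rlshift mulr0.
  - apply/matrixP => i j; rewrite -[in LHS]Bs !ord1 !mxE B0j.
    by rewrite eq_rlshift mulr0.
pose K : 'M[R]_(1 + n) := block_mx 1%:M 0 0 P'.
have KK : K *m K^T = 1%:M.
  rewrite tr_block_mx !trmx0 trmx1 mulmx_block !mulmx0 !mul0mx !mulmx1.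
  by rewrite !addr0 !add0r PP' -scalar_mx_block.
have {BE}BE : B = K^T *m diag_mx (row_mx a%:M D') *m K.
  rewrite tr_block_mx !trmx0 trmx1 diag_mx_row !mulmx_block.
  rewrite !mulmx0 !mul0mx !mulmx1 !mul1mx !addr0 !add0r -BE [LHS]BB.
  by rewrite ?mul0mx; congr block_mx; apply/matrixP => i j;
    rewrite !ord1 !mxE !eqxx.
move: K KK BE => K KK BE.
exists (K *m Q), (row_mx a%:M D'); rewrite trmx_mul Qs; split.
  by rewrite mulmxA -(mulmxA K Q Q) QQ mulmx1.
by rewrite AE BE !mulmxA.
Qed.

(** The rows of P are unit vectors. *)
Lemma orthogonal_entry_le1 n (P : 'M[R]_n) i j :
  P *m P^T = 1%:M -> `|P i j| <= 1.
Proof.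
move=> PP; have := congr1 (fun M : 'M[R]_n => M i i) PP.
rewrite !mxE eqxx (bigD1 j)//= mxE -expr2 => e.
rewrite -(ler_pXn2r (_ : 0 < 2)%N) ?nnegrE// expr1n real_normK ?num_real//.
rewrite -[leRHS]e lerDl; apply: sumr_ge0 => k _; by rewrite mxE -expr2 sqr_ge0.
Qed.

Lemma psd_sqrt_exists n (A : 'M[R]_n) : sym_psd A -> exists S, is_psd_sqrt A S.
Proof.
move=> [As A0]; have [P [D [PP AE]]] := spectral As.
have D0 i : 0 <= D 0 i.
  have := A0 (row i P); rewrite AE !rowE trmx_mul !mulmxA -(mulmxA _ P P^T) PP.
  rewrite mulmx1 -!mulmxA (mulmxA P) PP mul1mx mulmxA -rowE mxE (bigD1 i)//=.
  rewrite big1 => [|k ki]; last by rewrite !mxE (negbTE ki) ?andbF ?mulr0.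
  by rewrite !mxE !eqxx mulr1n mulr1 addr0.
pose E := map_mx Num.sqrt D.
exists (P^T *m diag_mx E *m P); split; [split|].
- by rewrite !trmx_mul trmxK tr_diag_mx mulmxA.
- move=> c; rewrite !mulmxA; set x := c *m P^T.
  have -> : x *m diag_mx E *m P *m c^T = x *m diag_mx E *m x^T.
    by rewrite /x trmx_mul trmxK !mulmxA.
  rewrite mxE; apply: sumr_ge0 => k _.
  by rewrite mul_mx_diag !mxE mulrAC mulr_ge0 ?sqrtr_ge0// -expr2 sqr_ge0.
- rewrite !mulmxA -(mulmxA _ P P^T) PP mulmx1 AE; congr (_ *m _).
  rewrite -mulmxA; congr (_ *m _); apply/matrixP => i j.
  rewrite mul_diag_mx !mxE; case: eqVneq => [->|]; rewrite ?mulr0// !mulr1n.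
  by rewrite -expr2 sqr_sqrtr.
Qed.

(** Let v be a unit eigenvector of D = S - T, with eigenvalue a. From
S^2 - T^2 = S D + D T one gets v (S^2 - T^2) v^T = a (v S v^T + v T v^T), while
a = v S v^T - v T v^T is at most v S v^T + v T v^T in absolute value because S
and T are positive. Hence a^2 <= |v (S^2 - T^2) v^T|, and all eigenvalues of D
are small when S^2 - T^2 is. *)
Lemma psd_sqrt_holder n (S T : 'M[R]_n) (eps : R) : sym_psd S -> sym_psd T ->
  (forall i j, `|(S *m S - T *m T) i j| <= eps) ->
  forall i j, `|(S - T) i j| <= n%:R ^+ 2 * Num.sqrt eps.
Proof.
move=> [Ss S0] [Ts T0] le_eps i0 j0.
have eps0 : 0 <= eps by exact: le_trans (le_eps i0 j0).
have [|P [D [PP DE]]] := @spectral _ (S - T); first by rewrite linearB /= Ss Ts.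
have lam k : `|D 0 k| <= n%:R * Num.sqrt eps.
  pose v := row k P.
  have vD : v *m (S - T) = D 0 k *: v.
    rewrite /v DE !mulmxA rowE -(mulmxA _ P) PP mulmx1 -rowE.
    rewrite row_diag_mx -scalemxAl -rowE.
    by [].
  have Dv : (S - T) *m v^T = D 0 k *: v^T.
    by rewrite -linearZ /= -vD trmx_mul linearB /= Ss Ts.
  have vv : (v *m v^T) 0 0 = 1.
    transitivity ((P *m P^T) k k); last by rewrite PP mxE eqxx.
    by rewrite !mxE; apply: eq_bigr => j _; rewrite !mxE.
  have e1 : (v *m (S *m S - T *m T) *m v^T) 0 0 =
      D 0 k * ((v *m S *m v^T) 0 0 + (v *m T *m v^T) 0 0).
    have -> : S *m S - T *m T = S *m (S - T) + (S - T) *m T.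
      by rewrite mulmxBr mulmxBl addrA subrK.
    rewrite mulmxDr mulmxDl !mulmxA vD -(mulmxA _ _ v^T) Dv -scalemxAr.
    by rewrite -!scalemxAl mxE [in X in X + _]mxE [in X in _ + X]mxE mulrDr.
  have e2 : D 0 k = (v *m S *m v^T) 0 0 - (v *m T *m v^T) 0 0.
    transitivity ((v *m (S - T) *m v^T) 0 0).
      by rewrite vD -scalemxAl mxE vv mulr1.
    by rewrite mulmxBr mulmxBl mxE [in X in _ + X]mxE.
  have le2 : `|(v *m (S *m S - T *m T) *m v^T) 0 0| <= n%:R ^+ 2 * eps.
    rewrite mxE (le_trans (ler_norm_sum _ _ _))//.
    rewrite (_ : _ * eps = \sum_(j < n) (n%:R * eps)); last first.
      by rewrite sumr_const card_ord -[RHS]mulr_natl mulrA -expr2.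
    apply: ler_sum => j _; rewrite normrM [in X in _ * X]mxE.
    rewrite (le_trans (ler_piMr _ _))//.
      by rewrite mxE orthogonal_entry_le1.
    rewrite mxE (le_trans (ler_norm_sum _ _ _))//.
    rewrite (_ : _ * eps = \sum_(i < n) eps); last first.
      by rewrite sumr_const card_ord -[RHS]mulr_natl.
    apply: ler_sum => i _; rewrite normrM (le_trans _ (le_eps i j))//.
    by rewrite ler_piMl// mxE orthogonal_entry_le1.
  rewrite -(ler_pXn2r (_ : 0 < 2)%N) ?nnegrE ?mulr_ge0 ?sqrtr_ge0 ?ler0n//.
  rewrite exprMn sqr_sqrtr// (le_trans _ le2)// e1 normrM expr2.
  rewrite ler_wpM2l// [in leLHS]e2 [leRHS]ger0_norm ?addr_ge0//.
  by rewrite (le_trans (ler_normB _ _))// !ger0_norm.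
rewrite DE mxE (le_trans (ler_norm_sum _ _ _))//.
rewrite (_ : _ * _ = \sum_(k < n) (n%:R * Num.sqrt eps)); last first.
  by rewrite sumr_const card_ord -[RHS]mulr_natl mulrA expr2.
apply: ler_sum => k _; rewrite normrM.
rewrite (le_trans (ler_piMr _ _)) ?orthogonal_entry_le1//.
rewrite mul_mx_diag !mxE normrM (le_trans _ (lam k))//.
by rewrite ler_piMl ?orthogonal_entry_le1.
Qed.

Lemma psd_sqrt_unique n (A S T : 'M[R]_n) :
  is_psd_sqrt A S -> is_psd_sqrt A T -> S = T.
Proof.
move=> [psdS SA] [psdT TA]; apply/subr0_eq/matrixP => i j; rewrite [RHS]mxE.
apply/eqP; rewrite -normr_le0.
rewrite (le_trans (@psd_sqrt_holder _ _ _ 0 psdS psdT _ i j)) ?sqrtr0 ?mulr0//.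
by move=> k l; rewrite SA TA subrr mxE normr0.
Qed.

Lemma psd_sqrtP n (A : 'M[R]_n) : sym_psd A -> is_psd_sqrt A (psd_sqrt A).
Proof. by move=> /psd_sqrt_exists[S AS]; exact: xgetPex (ex_intro _ S AS). Qed.

End spectral.

(** * Integration over the torus *)

Section integration.
Context {R : realType}.
Notation borel := (measurableTypeR R).

(** The unit cell is the box at 0 of side 1, and the boxes inside it are the
sets on which integrands are bounded below to show that integrals are
positive. *)
Definition box d (a : 'I_d -> R) (e : R) : set (d.-tuple borel) :=
  [set t | forall i, a i <= (tnth t i : R) < a i + e].

Lemma measurable_coord d (i : 'I_d) (D : set (d.-tuple borel)) :
  measurable_fun D (fun t => rV_of_tuple t 0 i).
Proof.
apply: measurable_funTS; rewrite (_ : (fun _ => _) = (@tnth _ borel ^~ i)).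
  exact: measurable_tnth.
by apply/funext => t; rewrite mxE.
Qed.

Lemma measurable_box d (a : 'I_d -> R) e : measurable (box a e).
Proof.
rewrite (_ : box a e =
    \bigcap_(i in [set: 'I_d])
      (fun t => rV_of_tuple t 0 i) @^-1` `[a i, a i + e[).
  apply: fin_bigcap_measurable => // i _; rewrite -[X in measurable X]setTI.
  exact: measurable_coord.
apply/seteqP; split=> t at_ i.
  by move=> _ /=; rewrite mxE in_itv; exact: at_.
by have := at_ i I; rewrite /= mxE in_itv.
Qed.

Lemma lebesgue_box d (a : 'I_d -> R) e : 0 <= e ->
  lebesgue_Rn d (box a e) = (e ^+ d)%:E.
Proof.
move=> e0; elim: d a => [|d IHd] a.
  by rewrite /= diracE expr0 mem_set// => -[].
rewrite /= /lebesgue_succ /pushforward.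
have -> : @tcons R d @^-1` box a e =
    `[a ord0, a ord0 + e[%classic `*` box (a \o lift ord0) e.
  apply/seteqP; split=> -[x t] /=.
    move=> at_; split; first by have := at_ ord0; rewrite in_itv.
    by move=> i; have := at_ (lift ord0 i); rewrite tnthS.
  move=> [+ at_] i; rewrite in_itv /= => ax.
  by case: (unliftP ord0 i) => [j|] ->; [rewrite tnthS; exact: at_|].
rewrite product_measure1E//; last exact: measurable_box.
rewrite IHd.
rewrite [X in (X * _)%E](_ : _ = e%:E).
  by rewrite exprS EFinM.
  apply: (etrans (lebesgue_measure_itv _)); rewrite /= lte_fin ltrDl.
  case: ltgtP e0 => // [e0 _|<- _] //; by rewrite -EFinB addrAC subrr add0r.
Qed.

(** On a space of finite measure these functions are integrable, and unlike the
integrable functions they are stable under products. The bound holds on the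
whole space because the functions at hand are periodic. *)
Definition bounded_measurable d (g : 'rV[R]_d -> R) : Prop :=
  measurable_fun setT (g \o @rV_of_tuple R d) /\ exists M, forall x, `|g x| <= M.

Lemma bounded_measurable_cst d (c : R) :
  bounded_measurable (fun _ : 'rV[R]_d => c).
Proof. by split; [exact: measurable_cst|exists `|c|]. Qed.

Lemma bounded_measurableD d (g h : 'rV[R]_d -> R) :
  bounded_measurable g -> bounded_measurable h ->
  bounded_measurable (fun x => g x + h x).
Proof.
move=> [mg [M gM]] [mh [N hN]]; split; first exact: measurable_funD.
by exists (M + N) => x; rewrite (le_trans (ler_normD _ _))// lerD.
Qed.

Lemma bounded_measurableM d (g h : 'rV[R]_d -> R) :
  bounded_measurable g -> bounded_measurable h ->
  bounded_measurable (fun x => g x * h x).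
Proof.
move=> [mg [M gM]] [mh [N hN]]; split; first exact: measurable_funM.
by exists (M * N) => x; rewrite normrM ler_pM.
Qed.

Lemma bounded_measurableZ d c (g : 'rV[R]_d -> R) :
  bounded_measurable g -> bounded_measurable (fun x => c * g x).
Proof. by apply: bounded_measurableM; exact: bounded_measurable_cst. Qed.

Lemma bounded_measurable_sum d I (r : seq I) (g : I -> 'rV[R]_d -> R) :
  (forall i, bounded_measurable (g i)) ->
  bounded_measurable (fun x => \sum_(i <- r) g i x).
Proof.
move=> bg; elim: r => [|i r IHr].
  by under eq_fun do rewrite big_nil; exact: bounded_measurable_cst.
by under eq_fun do rewrite big_cons; exact: bounded_measurableD.
Qed.

Lemma bounded_measurable_max0 d (g : 'rV[R]_d -> R) :
  bounded_measurable g -> bounded_measurable (fun x => Num.max (g x) 0).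
Proof.
move=> [mg [M gM]]; split; first exact: measurable_maxr.
exists M => x; rewrite (le_trans _ (gM x))//.
by rewrite /Num.max; case: ifP; rewrite ?normr0.
Qed.

Lemma bounded_measurable_norm d (g : 'rV[R]_d -> R) :
  bounded_measurable g -> bounded_measurable (fun x => `|g x|).
Proof.
move=> [mg [M gM]]; split; first exact: measurableT_comp.
by exists M => x; rewrite normr_id.
Qed.

Let cell d : set (d.-tuple borel) := [set t | forall i, 0 <= (tnth t i : R) < 1].

Let cellE d : @cell d = box (fun=> 0) 1.
Proof. by apply/seteqP; split=> t /= ct i; have := ct i; rewrite add0r. Qed.

Let measurable_cell d : measurable (@cell d).
Proof. by rewrite cellE; exact: measurable_box. Qed.

Let lebesgue_cell d : lebesgue_Rn d (@cell d) = 1%E.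
Proof. by rewrite cellE lebesgue_box// expr1n. Qed.

Lemma bounded_measurable_integrable d (g : 'rV[R]_d -> R) :
  bounded_measurable g ->
  (lebesgue_Rn d).-integrable [set t | forall i, 0 <= (tnth t i : R) < 1]
    (EFin \o (fun t => g (rV_of_tuple t))).
Proof.
move=> [mg [M gM]]; apply: measurable_bounded_integrable.
- exact: measurable_cell.
- have cell1 : (lebesgue_Rn d (@cell d) <= 1)%E by rewrite lebesgue_cell.
  exact: le_lt_trans cell1 (ltry _).
- exact: measurable_funTS.
- exists M; split=> [|N MN t _]; first exact: num_real.
  exact: le_trans (gM _) (ltW MN).
Qed.

Lemma torus_intD d (g h : 'rV[R]_d -> R) :
  bounded_measurable g -> bounded_measurable h ->
  torus_int (fun x => g x + h x) = torus_int g + torus_int h.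
Proof.
by move=> bg bh; apply: RintegralD => //;
  (exact: measurable_cell || exact: bounded_measurable_integrable).
Qed.

Lemma torus_intZ d c (g : 'rV[R]_d -> R) : bounded_measurable g ->
  torus_int (fun x => c * g x) = c * torus_int g.
Proof.
by move=> bg; apply: RintegralZl => //;
  (exact: measurable_cell || exact: bounded_measurable_integrable).
Qed.

Lemma torus_int_cst d c : torus_int (fun _ : 'rV[R]_d => c) = c.
Proof. 
rewrite /torus_int Rintegral_cst; last exact: measurable_cell.
by rewrite [X in fine X](_ : _ = 1%E) ?mulr1//; exact: lebesgue_cell.
Qed.

Lemma torus_int_ge0 d (g : 'rV[R]_d -> R) :
  (forall x, 0 <= g x) -> 0 <= torus_int g.
Proof. by move=> g0; apply: Rintegral_ge0. Qed.

Lemma le_torus_int d (g h : 'rV[R]_d -> R) :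
  bounded_measurable g -> bounded_measurable h -> (forall x, g x <= h x) ->
  torus_int g <= torus_int h.
Proof.
by move=> bg bh gh; apply: le_Rintegral => //;
  (exact: measurable_cell || exact: bounded_measurable_integrable).
Qed.

Lemma le_norm_torus_int d (g : 'rV[R]_d -> R) : bounded_measurable g ->
  `|torus_int g| <= torus_int (fun x => `|g x|).
Proof.
by move=> bg; apply: le_normr_Rintegral => //;
  (exact: measurable_cell || exact: bounded_measurable_integrable).
Qed.

Lemma torus_int_gt0 d (g : 'rV[R]_d -> R) (a : 'I_d -> R) (e c : R) :
  bounded_measurable g -> (forall x, 0 <= g x) -> 0 < e -> 0 < c ->
  (forall i, 0 <= a i /\ a i + e <= 1) ->
  (forall x : 'rV_d, (forall i, a i <= x 0 i < a i + e) -> c <= g x) ->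
  0 < torus_int g.
Proof.
move=> bg g0 e0 c0 ae cg; rewrite /torus_int /Rintegral.
have intg := bounded_measurable_integrable bg.
have mg : measurable_fun (@cell d) (fun t => (g (rV_of_tuple t))%:E).
  exact: (measurable_int (lebesgue_Rn d)).
have sub : box a e `<=` @cell d.
  move=> t at_ i; have /andP[h1 h2] := at_ i; have [a0 a1] := ae i.
  by apply/andP; split; [exact: le_trans a0 h1|exact: lt_le_trans h2 a1].
rewrite fine_gt0//; apply/andP; split; last first.
  rewrite -ge0_fin_numE; last by apply: integral_ge0 => t _; rewrite lee_fin.
  by apply: integrable_fin_num => //; exact: measurable_cell.
apply: (@lt_le_trans _ _ (c%:E * lebesgue_Rn d (box a e))%E).
  by rewrite lebesgue_box ?ltW// -EFinM lte_fin mulr_gt0// exprn_gt0.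
rewrite -integral_cst; last exact: measurable_box.
apply: (@le_trans _ _
    (\int[lebesgue_Rn d]_(t in box a e) (g (rV_of_tuple t))%:E)%E).
  apply: ge0_le_integral => //=.
  - exact: measurable_box.
  - by move=> t _; rewrite lee_fin ltW.
  - by apply: measurable_funS mg => //; exact: measurable_cell.
  - by move=> t at_; rewrite lee_fin cg// => i; rewrite mxE.
apply: ge0_subset_integral => //.
  exact: measurable_box.
exact: measurable_cell.
by move=> t _; rewrite lee_fin.
Qed.

End integration.

(** * Nonvanishing of polynomials in several variables *)

Section polynomials.
Context {R : realType}.

(** A nonzero polynomial has fewer roots than there are points e / (k + 2). *)
Lemma poly_nonroot_near0 (P : {poly R}) e : P != 0 -> 0 < e ->
  exists t, [/\ 0 < t, t < e & P.[t] != 0].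
Proof.
move=> P0 e0; pose s := [seq e / k.+2%:R | k <- iota 0 (size P)].
have us : uniq s.
  rewrite map_inj_uniq ?iota_uniq// => i j /(mulfI (lt0r_neq0 e0))/invr_inj.
  by move=> /eqP; rewrite eqr_nat => /eqP[].
have [Ps|/allPn[t]] := boolP (all (root P) s).
  by have := max_poly_roots P0 Ps us; rewrite size_map size_iota ltnn.
case/mapP => k _ -> Pt; exists (e / k.+2%:R); split=> //.
  by rewrite divr_gt0.
by rewrite ltr_pdivrMr// ltr_pMr// ltr1n.
Qed.

(** The digit of weight 1 is the residue of the sum modulo N; induct on the
quotient. *)
Lemma digits_inj N n (f g : 'I_n -> nat) :
  (forall i, f i < N)%N -> (forall i, g i < N)%N ->
  (\sum_i f i * N ^ i = \sum_i g i * N ^ i)%N -> f =1 g.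
Proof.
elim: n f g => [|n IHn] f g fN gN; first by move=> _ [].
rewrite !big_ord_recl /= !expn0 !muln1.
have shift (h : 'I_n.+1 -> nat) : (\sum_(i < n) h (lift ord0 i) * N ^ bump 0 i =
    (\sum_(i < n) h (lift ord0 i) * N ^ i) * N)%N.
  by rewrite big_distrl /=; apply: eq_bigr => i _; rewrite expnSr mulnA.
rewrite !shift => e.
have e0 : f ord0 = g ord0.
  have := congr1 (modn^~ N) e; rewrite /= ![(_ + _ * N)%N]addnC !modnMDl.
  by rewrite !modn_small.
have N0 : (0 < N)%N by exact: leq_ltn_trans (fN ord0).
move: e; rewrite e0 => /addnI/eqP; rewrite eqn_pmul2r// => /eqP e.
move=> i; case: (unliftP ord0 i) => [j|] ->//.
by apply: (IHn (f \o lift ord0) (g \o lift ord0)) => //= k.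
Qed.

(** Kronecker substitution: on the curve with coordinates t ^ (N ^ i), where N
exceeds the degree, distinct monomials of p become distinct powers of t, so p
becomes a nonzero polynomial in t. *)
Lemma mpoly_nonzero_point n (p : mpoly n R) : p != 0 ->
  exists v, meval v p != 0.
Proof.
move=> p0; pose N := msize p.
pose kappa (m : multinom n) := (\sum_i m i * N ^ i)%N.
pose P := \sum_(m <- msupp p) mcoeff m p *: 'X^(kappa m) : {poly R}.
have suppN m i : m \in msupp p -> (m i < N)%N.
  move=> /msize_mdeg_lt; apply: leq_ltn_trans.
  by rewrite mdegE (bigD1 i)//= leq_addr.
have [m0 m0p] : exists m, m \in msupp p.
  by exists (mlead p); exact: mlead_supp.
have P0 : P != 0.
  apply/eqP => /(congr1 (fun Q : {poly R} => Q`_(kappa m0))).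
  rewrite coef_sum coef0 (bigD1_seq m0)//= ?msupp_uniq// big1_seq.
    rewrite coefZ coefXn eqxx mulr1 addr0 => /eqP; apply/negP.
    by rewrite -mcoeff_msupp.
  move=> m /andP[mm0 mp]; rewrite coefZ coefXn.
  case: eqP => [e|_]; last by rewrite mulr0.
  case/eqP: mm0; apply/mnmP; apply: (@digits_inj N) => // i; exact: suppN.
have [t [_ _ Pt]] := poly_nonroot_near0 P0 ltr01.
exists (fun i => t ^+ (N ^ i)); apply: contraNneq Pt.
rewrite mevalE horner_sum => e; apply/eqP; rewrite -[RHS]e.
apply: eq_bigr => m _; rewrite hornerZ hornerXn; congr (_ * _).
rewrite /kappa expr_sum; apply: eq_bigr => i _.
by rewrite -exprM mulnC.
Qed.

(** Along the line from a to a point v where p does not vanish, p is a nonzero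
polynomial in the parameter, so it has a nonzero value arbitrarily close to
a. *)
Lemma mpoly_nonzero_near n (p : mpoly n R) (a : 'I_n -> R) (e : R) :
  p != 0 -> 0 < e ->
  exists y : 'I_n -> R, (forall i, `|y i - a i| < e) /\ meval y p != 0.
Proof.
move=> p0 e0; have [v pv] := mpoly_nonzero_point p0.
pose P := \sum_(m <- msupp p)
  mcoeff m p *: \prod_i ((a i)%:P + (v i - a i) *: 'X) ^+ m i : {poly R}.
have PE t : P.[t] = meval (fun i => a i + t * (v i - a i)) p.
  rewrite mevalE horner_sum; apply: eq_bigr => m _.
  rewrite hornerZ horner_prod; congr (_ * _); apply: eq_bigr => i _.
  by rewrite !hornerE mulrC.
have P0 : P != 0.
  apply: contraNneq pv => P0; have := PE 1; rewrite P0 horner0 => e1.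
  apply/eqP; rewrite [RHS]e1; apply: meval_eq => i.
  by rewrite mul1r addrC subrK.
(* Bounds every |v i - a i|, so that moving by t < e / D stays within e; the
   summand 1 makes it positive. *)
pose D := 1 + \sum_i `|v i - a i|.
have D0 : 0 < D by rewrite ltr_pwDl ?ltr01// sumr_ge0.
have [t [t0 te Pt]] := poly_nonroot_near0 P0 (divr_gt0 e0 D0).
exists (fun i => a i + t * (v i - a i)); split; last by rewrite -PE.
move=> i; rewrite addrAC subrr add0r normrM gtr0_norm//.
apply: (@le_lt_trans _ _ (t * D)); last by rewrite -ltr_pdivlMr.
rewrite (ler_wpM2l (ltW t0))// /D (bigD1 i)//= addrCA lerDl.
by rewrite addr_ge0// sumr_ge0.
Qed.

End polynomials.

(** * Barycentric coordinates *)

Section barycentric.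
Context {R : realType} {d : nat} (w : 'I_d.+1 -> 'rV[R]_d).

(** The coordinates at the vertices other than the first solve the linear system
given by the edge vectors; the remaining one makes the sum equal to 1. *)
Definition bary (x : 'rV[R]_d) (i : 'I_d.+1) : R :=
  let c := (x - w ord0) *m invmx (edge_mx w) in
  if unlift ord0 i is Some j then c 0 j else 1 - \sum_j c 0 j.

(** Both the measurability and the continuity of the coordinates come from this
form. *)
Lemma bary_affine i : exists b (l : 'I_d -> R),
  forall x, bary x i = b + \sum_k x 0 k * l k.
Proof.
rewrite /bary; set V := invmx _; set c := w ord0 *m V.
have cE (x : 'rV_d) j : ((x - w ord0) *m V) 0 j = \sum_k x 0 k * V k j - c 0 j.
  by rewrite mulmxBl [LHS]mxE [X in _ + X]mxE; congr (_ + _); rewrite mxE.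
case: unliftP => [j|] _.
  by exists (- c 0 j), (fun k => V k j) => x; rewrite cE addrC.
exists (1 + \sum_j c 0 j), (fun k => - \sum_j V k j) => x.
under eq_bigr do rewrite cE.
rewrite sumrB opprB addrA; congr (_ + _).
rewrite exchange_big/= -sumrN; apply: eq_bigr => k _.
by rewrite mulrN mulr_sumr.
Qed.

Hypothesis w_free : row_free (edge_mx w).

Let edge_unit : edge_mx w \in unitmx.
Proof. by rewrite -row_free_unit. Qed.

Lemma affine_comb (c : 'I_d.+1 -> R) : \sum_i c i = 1 ->
  \sum_i c i *: w i = w ord0 + (\row_j c (lift ord0 j)) *m edge_mx w.
Proof.
move=> c1; rewrite -[in X in X + _](scale1r (w ord0)) -c1.
rewrite !big_ord_recl scalerDl -addrA; congr (_ + _).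
rewrite scaler_suml mulmx_sum_row -big_split/=; apply: eq_bigr => j _.
by rewrite mxE rowK -scalerDr addrC subrK.
Qed.

Lemma bary_sum1 x : \sum_i bary x i = 1.
Proof.
rewrite big_ord_recl /bary unlift_none.
under [X in _ + X]eq_bigr do rewrite liftK.
by rewrite subrK.
Qed.

Lemma bary_comb x : \sum_i bary x i *: w i = x.
Proof.
rewrite affine_comb ?bary_sum1//.
rewrite (_ : \row_j _ = (x - w ord0) *m invmx (edge_mx w)).
  by rewrite mulmxKV// addrC subrK.
by apply/rowP => j; rewrite mxE /bary liftK.
Qed.

Lemma bary_unique (c : 'I_d.+1 -> R) : \sum_i c i = 1 ->
  bary (\sum_i c i *: w i) =1 c.
Proof.
move=> c1 i; rewrite affine_comb// /bary addrAC subrr add0r mulmxK//.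
case: unliftP => [j|] ->; first by rewrite mxE.
under eq_bigr do rewrite mxE; rewrite -c1 big_ord_recl /=.
by rewrite addrK.
Qed.

Lemma open_simplexP x : open_simplex w x <-> forall i, 0 < bary x i.
Proof.
split=> [[c [c0 c1 ->]] i|b0]; first by rewrite bary_unique.
by exists (bary x); split; rewrite ?bary_sum1 ?bary_comb.
Qed.

(** A point with positive coordinates lies on no proper face. *)
Lemma open_simplex_face (A : {set 'I_d.+1}) x :
  open_simplex w x -> face w A x -> A = [set: 'I_d.+1]%SET.
Proof.
move=> /open_simplexP b0 [c [c0 cA c1 xE]]; apply/setP => i; rewrite inE.
by apply: contraTT (b0 i) => /cA ci; rewrite xE bary_unique// ci ltxx.
Qed.

Lemma measurable_open_simplex z :
  measurable [set t | open_simplex w (rV_of_tuple t + z)].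
Proof.
have -> : [set t | open_simplex w (rV_of_tuple t + z)] =
    \bigcap_(i in [set: 'I_d.+1])
      (fun t => bary (rV_of_tuple t + z) i) @^-1` `]0, +oo[.
  apply/seteqP; split=> t /=.
    by move=> /open_simplexP b0 i _ /=; rewrite in_itv/= b0.
  move=> b0; apply/open_simplexP => i.
  by have := b0 i I; rewrite /= in_itv/= andbT.
apply: fin_bigcap_measurable => // i _; rewrite -[X in measurable X]setTI.
have [b [l ->]] : exists b l, (fun t => bary (rV_of_tuple t + z) i) =
    (fun t => b + \sum_k (rV_of_tuple t + z) 0 k * l k).
  have [b [l bE]] := bary_affine i.
  by exists b, l; apply/funext => t; exact: bE.
suff : measurable_fun setT (fun t : d.-tuple (measurableTypeR R) =>
    b + \sum_k (rV_of_tuple t + z) 0 k * l k) by apply.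
apply: measurable_funD => //; apply: measurable_sum => k.
apply: measurable_funM => //.
under eq_fun do rewrite mxE; apply: measurable_funD => //.
exact: measurable_coord.
Qed.

Lemma continuous_bary i : continuous (bary ^~ i).
Proof.
have [b [l bE]] := bary_affine i.
rewrite (_ : bary ^~ i = fun x => b + \sum_k x 0 k * l k); last exact/funext.
have lc : continuous (fun x : 'rV[R]_d => \sum_k x 0 k * l k).
  apply: continuous_big => [|k _ x]; first exact: add_continuous.
  by apply: continuousM; [exact: coord_continuous|exact: cst_continuous].
move=> x; apply: (@continuousD _ _ _ (fun=> b)); last exact: lc.
exact: cst_continuous.
Qed.

Lemma nbhs_open_simplex x : open_simplex w x -> nbhs x (open_simplex w).
Proof.
move=> /open_simplexP b0.
have : \forall y \near x, forall i, 0 < bary y i.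
  apply: (@filter_forall _ _ (fun i y => 0 < bary y i) _ (nbhs_filter x)) => i.
  apply: (cvgr_gt (bary x i)) => //; exact: continuous_bary.
by apply: filterS => y; exact: (open_simplexP y).2.
Qed.

Lemma simplex_bounded x k : simplex w x -> `|x 0 k| <= \sum_i `|w i 0 k|.
Proof.
move=> [c [c0 _ c1 ->]]; rewrite summxE (le_trans (ler_norm_sum _ _ _))//.
apply: ler_sum => i _; rewrite mxE normrM ler_piMl// ger0_norm// -c1.
by rewrite (bigD1 i)//= lerDl sumr_ge0.
Qed.

Lemma open_simplex_sub : open_simplex w `<=` simplex w.
Proof.
move=> x [c [c0 c1 ->]]; exists c; split=> // [i|i]; first exact: ltW.
by rewrite inE.
Qed.

Lemma open_simplex_nonempty : exists x, open_simplex w x.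
Proof.
exists (\sum_i d.+1%:R^-1 *: w i), (fun=> d.+1%:R^-1); split=> //.
by rewrite sumr_const card_ord -[LHS]mulr_natl mulfV.
Qed.

End barycentric.

(** * Polynomials as functions *)

Section peval.
Context {R : realType} {d l : nat}.

Lemma peval_linear a (q r : Defs.polyn R d l) x :
  peval (a *: q + r) x = a * peval q x + peval r x.
Proof. by rewrite /peval /= mevalD mevalZ. Qed.

Lemma measurable_peval (q : Defs.polyn R d l) z D :
  measurable_fun D (fun t => peval q (rV_of_tuple t + z)).
Proof.
apply: measurable_funTS; rewrite /peval; under eq_fun do rewrite mevalE.
apply: measurable_sum => m; apply: measurable_funM => //.
apply: measurable_prod => i _; apply: measurable_funX.
under eq_fun do rewrite mxE; apply: measurable_funD => //.
exact: measurable_coord.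
Qed.

Lemma continuous_peval (q : Defs.polyn R d l) : continuous (peval q).
Proof.
rewrite (_ : peval q = fun x => \sum_(m <- msupp (polyn_val q))
    mcoeff m (polyn_val q) * \prod_i x 0 i ^+ m i); last first.
  by apply/funext => x; exact: mevalE.
have monomial (m : multinom d) :
    continuous (fun x : 'rV[R]_d => \prod_i x 0 i ^+ m i).
  apply: continuous_big => [|i _ x]; first exact: mul_continuous.
  apply: (@continuous_comp _ _ _ (fun x : 'rV[R]_d => x 0 i) (@GRing.exp R ^~ _)).
    exact: coord_continuous.
  exact: exprn_continuous.
apply: continuous_big => [|m _ x]; first exact: add_continuous.
apply: continuousM; [exact: cst_continuous|exact: monomial].
Qed.

Lemma peval_bounded (q : Defs.polyn R d l) (B : 'I_d -> R) :
  exists M, forall x : 'rV_d, (forall i, `|x 0 i| <= B i) -> `|peval q x| <= M.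
Proof.
exists (\sum_(m <- msupp (polyn_val q))
  `|mcoeff m (polyn_val q)| * \prod_i B i ^+ m i).
move=> x xB; rewrite /peval mevalE (le_trans (ler_norm_sum _ _ _))//.
apply: ler_sum => m _; rewrite normrM ler_wpM2l// normr_prod.
apply: ler_prod => i _; rewrite normr_ge0 normrX /= lerXn2r ?nnegrE//.
exact: le_trans (xB i).
Qed.

End peval.

(** * Piecewise polynomials on the torus *)

Section dg_functions.
Context {R : realType} {d : nat}.

Lemma latticeB (x y : 'rV[R]_d) : lattice x -> lattice y -> lattice (x - y).
Proof. by move=> lx ly i; rewrite !mxE rpredB. Qed.

Lemma lattice_intr (k : 'rV[int]_d) : lattice (map_mx intr k : 'rV[R]_d).
Proof. by move=> i; rewrite mxE intr_int. Qed.

Lemma latticeP (z : 'rV[R]_d) :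
  lattice z -> exists k : 'rV[int]_d, z = map_mx intr k.
Proof.
move=> lz; exists (\row_i Num.floor (z 0 i)); apply/rowP => i.
by rewrite !mxE floorK.
Qed.

Variable T : mesh R d.

(** Two lifts of x in the closed element would differ by a nonzero lattice vector,
and the element is disjoint from its nonzero lattice translates. *)
Lemma lift_to_unique (K : elt T) x y :
  simplex (vertex T K) y -> lattice (y - x) -> lift_to K x = y.
Proof.
move=> sy ly; rewrite /lift_to; case: xgetP => [y' _ [sy' ly']|/(_ y)[]//].
apply/eqP; rewrite -subr_eq0; apply: contrapT => /negP yy'.
have lz : lattice (y' - y).
  by rewrite -(subrKA x) -[x - y]opprB; exact: latticeB.
have /seteqP[+ _] := mesh_embedded K lz yy'; apply; split; first exact: sy'.
by rewrite /translate/= opprB addrC subrK.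
Qed.

(** Lifts of a common point show that K meets a translate of K' at an interior
point of K; but by conformity the two meet in a proper face of K. *)
Lemma elt_interior_disjoint (K K' : elt T) x :
  elt_interior K x -> elt_interior K' x -> K = K'.
Proof.
move=> [y oy ly] [y' oy' ly']; apply/eqP; apply: contrapT => /negP KK'.
have lz : lattice (y - y').
  by rewrite -(subrKA x) -[x - y']opprB; exact: latticeB.
have [A [A' [+ _ SA _]]] := mesh_conforming lz KK'.
have : face (vertex T K) A y.
  rewrite -SA; split; first exact: open_simplex_sub.
  by rewrite /translate/= opprB addrC subrK; exact: open_simplex_sub.
move=> /(open_simplex_face (mesh_nondegenerate K) oy) ->.
by rewrite cardsT card_ord ltnn.
Qed.

Lemma restr_interior l (u : dg T l) (K : elt T) x y :
  open_simplex (vertex T K) y -> lattice (y - x) -> restr u K x = peval (u K) y.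
Proof.
by move=> oy ly; rewrite /restr (lift_to_unique (open_simplex_sub oy) ly).
Qed.

(** In the sum over the elements defining the function, only the term of K
survives at an interior point of K. *)
Lemma dg_fun_interior l (u : dg T l) (K : elt T) x y :
  open_simplex (vertex T K) y -> lattice (y - x) -> dg_fun u x = peval (u K) y.
Proof.
move=> oy ly; have Kx : elt_interior K x by exists y.
rewrite /dg_fun (bigD1 K)//= indicE mem_set// mul1r (restr_interior _ oy ly).
rewrite big1 ?addr0// => K' KK'; rewrite indicE memNset ?mul0r// => K'x.
by move/eqP: KK'; apply; exact: elt_interior_disjoint K'x Kx.
Qed.

Lemma dg_fun_linear l a (u v : dg T l) x :
  dg_fun (a *: u + v) x = a * dg_fun u x + dg_fun v x.
Proof.
rewrite /dg_fun mulr_sumr -big_split; apply: eq_bigr => K _ /=.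
by rewrite /restr !ffunE peval_linear mulrDr mulrCA.
Qed.

(** The interior of an element in the torus is the countable union of the integer
translates of an open simplex. On each translate the function is a shifted
polynomial, and elsewhere its term is 0. *)
Lemma bounded_measurable_dg_fun l (u : dg T l) : bounded_measurable (dg_fun u).
Proof.
apply: bounded_measurable_sum => K; split; last first.
  have [M uM] := peval_bounded (u K) (fun k => \sum_i `|vertex T K i 0 k|).
  exists `|M| => x; rewrite indicE.
  have [Kx|Kx] := pselect (elt_interior K x); last first.
    by rewrite memNset// mul0r normr0.
  have [y oy ly] := Kx; rewrite mem_set// mul1r (restr_interior _ oy ly).
  rewrite (le_trans _ (ler_norm M))// uM// => i.
  exact/simplex_bounded/open_simplex_sub.
pose shift (k : 'rV[int]_d) (t : d.-tuple (measurableTypeR R)) :=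
  rV_of_tuple t + map_mx intr k.
pose E k := [set t | open_simplex (vertex T K) (shift k t)].
have mE k : measurable (E k).
  exact: (measurable_open_simplex (mesh_nondegenerate K)).
have cZ : countable [set: 'rV[int]_d] by exact: countableP.
have EP t : (\bigcup_k E k) t <-> elt_interior K (rV_of_tuple t).
  split=> [[k _ Ek]|[y oy /latticeP[k yk]]].
    exists (shift k t) => //; rewrite /shift addrAC subrr add0r.
    exact: lattice_intr.
  by exists k => //; rewrite /E/= /shift -yk addrC subrK.
move=> _ Y mY; rewrite setTI.
rewrite (_ : _ @^-1` Y =
    \bigcup_k (E k `&` (fun t => peval (u K) (shift k t)) @^-1` Y) `|`
    (~` (\bigcup_k E k) `&` cst 0 @^-1` Y)).
  apply: measurableU.
    apply: countable_bigcupT_measurable => // k.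
    exact: (measurable_peval (u K) _ (mE k)).
  apply: measurableI.
    by apply: measurableC; exact: countable_bigcupT_measurable.
  by rewrite -[X in measurable X]setTI; exact: measurable_cst.
apply/seteqP; split=> t /=.
  have [Kt|Kt] := pselect (elt_interior K (rV_of_tuple t)).
    rewrite indicE mem_set// mul1r => Yt; left.
    have [k _ Ek] := (EP t).2 Kt; exists k => //; split=> //=.
    rewrite -(@restr_interior _ u _ (rV_of_tuple t))// /shift.
    by rewrite addrAC subrr add0r; exact: lattice_intr.
  rewrite indicE memNset// mul0r => Y0; right; split=> //.
  by move=> /EP.
case=> [[k _ [Ek /= Yk]]|[Et Y0]].
  have Kt : elt_interior K (rV_of_tuple t) by apply/EP; exists k.
  rewrite indicE mem_set// mul1r (@restr_interior _ _ _ _ (shift k t))// /shift.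
  by rewrite addrAC subrr add0r; exact: lattice_intr.
by rewrite indicE memNset ?mul0r// => /EP.
Qed.

(** The polynomial of u on some element K is nonzero, so it is nonzero at some
point y of the open simplex, hence bounded away from 0 on a neighbourhood of
y. Translating y by its integer part moves a box at y into the unit cell; the
side e is small enough for the box to stay in the cell and, once translated
back, in this neighbourhood. *)
Lemma dg_positive_box l (u : dg T l) : u != 0 ->
  exists (a : 'I_d -> R) e c, [/\ 0 < e, 0 < c,
    forall i, 0 <= a i /\ a i + e <= 1 &
    forall x : 'rV_d, (forall i, a i <= x 0 i < a i + e) -> c <= dg_fun u x ^+ 2].
Proof.
move=> u0; have [K uK] : exists K, u K != 0.
  apply/existsP; apply: contraNT u0 => /existsPn u0; apply/eqP/ffunP => K.
  by rewrite ffunE; apply/eqP; have := u0 K; rewrite negbK.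
have wf := mesh_nondegenerate K.
have [b ob] := open_simplex_nonempty (vertex T K).
have /nbhs_ballP[r r0 br] := nbhs_open_simplex wf ob.
have uK' : polyn_val (u K) != 0.
  by apply: contraNneq uK => uK; apply/eqP/val_inj.
have [y' [y'b py]] := mpoly_nonzero_near (b 0) uK' r0.
pose y : 'rV[R]_d := \row_i y' i.
have {y'b}oy : open_simplex (vertex T K) y.
  apply: br; split=> // i j; rewrite !ord1 /ball/= mxE distrC; exact: y'b.
have {}py : peval (u K) y != 0.
  by rewrite /peval (@meval_eq _ _ _ y')// => i; rewrite mxE.
move: y oy py => y oy py.
have : nbhs y (open_simplex (vertex T K) `&`
    [set x | `|peval (u K) y| / 2 < `|peval (u K) x|]).
  apply: (@filterI _ _ (nbhs_filter y)); first exact: nbhs_open_simplex.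
  refine (@cvgr_norm_gt R R^o _ _ (nbhs_filter y) _ (peval (u K) y) _ _ _).
    exact: continuous_peval.
  by rewrite gtr_pMr ?normr_gt0// invf_lt1// ltr1n.
move=> /nbhs_ballP[s /= s0 ys].
pose z : 'rV[int]_d := \row_i Num.floor (y 0 i).
pose a i := y 0 i - (Num.floor (y 0 i))%:~R.
have a1 i : a i < 1.
  by rewrite /a; have := lt_succ_floor (y 0 i); rewrite intrD; lra.
(* The side must not exceed s, nor the room 1 - a i left in the cell. *)
pose e := \big[Num.min/s]_i (1 - a i).
exists a, e, ((`|peval (u K) y| / 2) ^+ 2); split.
- by apply: lt_bigmin => // i _; rewrite subr_gt0.
- by rewrite exprn_gt0// divr_gt0 ?normr_gt0.
- move=> i; split; first by rewrite subr_ge0 floor_le.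
  by rewrite -lerBrDl; exact: bigmin_le_cond.
move=> x ax; pose y1 := x + map_mx intr z.
have [|oy1 py1] := ys y1.
  split=> // i j; rewrite !ord1 /ball/= !mxE distrC.
  have /andP[] := ax j; rewrite /a => x1 x2.
  have es : e <= s by exact: bigmin_le_id.
  by rewrite ltr_norml; apply/andP; split; lra.
rewrite (dg_fun_interior _ oy1); last first.
  by rewrite /y1 addrAC subrr add0r; exact: lattice_intr.
by rewrite -[leRHS]real_normK ?num_real// lerXn2r ?nnegrE ?divr_ge0// ltW.
Qed.

End dg_functions.

(** * Weighted inner products and their Gram matrices *)

Section weighted_forms.
Context {R : realType} {d l : nat} {T : mesh R d}.
Implicit Types (u v w : dgv T l) (k : 'rV[R]_d -> R).

Lemma dot_dgv_fun v w x : dot (dgv_fun v x) (dgv_fun w x) =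
  \sum_i dg_fun (dgv_comp v i) x * dg_fun (dgv_comp w i) x.
Proof. by apply: eq_bigr => i _; rewrite !mxE. Qed.

Lemma bounded_measurable_dot v w :
  bounded_measurable (fun x => dot (dgv_fun v x) (dgv_fun w x)).
Proof.
under eq_fun do rewrite dot_dgv_fun.
apply: bounded_measurable_sum => i.
by apply: bounded_measurableM; exact: bounded_measurable_dg_fun.
Qed.

(** The weight 1 gives the inner product and the positive part of u gives the
weighted matrix, so both Gram matrices obey the same rules. *)
Definition weighted_ip k v w : R :=
  torus_int (fun x => k x * dot (dgv_fun v x) (dgv_fun w x)).

Lemma ip_weighted v w : ip v w = weighted_ip (fun=> 1) v w.
Proof. by rewrite /weighted_ip; under [in RHS]eq_fun do rewrite mul1r. Qed.

Lemma weighted_ipC k v w : weighted_ip k v w = weighted_ip k w v.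
Proof. by rewrite /weighted_ip; under eq_fun do rewrite dotC. Qed.

Lemma dgv_fun_linear a u v x :
  dgv_fun (a *: u + v) x = a *: dgv_fun u x + dgv_fun v x.
Proof.
apply/rowP => i; rewrite !mxE -dg_fun_linear; congr (dg_fun _ x).
by apply/ffunP => K; rewrite !ffunE.
Qed.

Lemma dot_linearl n a (x y z : 'rV[R]_n) :
  dot (a *: x + y) z = a * dot x z + dot y z.
Proof.
rewrite /dot mulr_sumr -big_split; apply: eq_bigr => i _ /=.
by rewrite !mxE mulrDl mulrA.
Qed.

Lemma weighted_ip_linearl k a u v w : bounded_measurable k ->
  weighted_ip k (a *: u + v) w = a * weighted_ip k u w + weighted_ip k v w.
Proof.
move=> bk.
have bkd v1 v2 :
    bounded_measurable (fun x => k x * dot (dgv_fun v1 x) (dgv_fun v2 x)).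
  exact: bounded_measurableM bk (bounded_measurable_dot _ _).
rewrite /weighted_ip -torus_intZ// -torus_intD//; last exact: bounded_measurableZ.
congr torus_int; apply/funext => x.
by rewrite dgv_fun_linear dot_linearl mulrDr mulrCA.
Qed.

Lemma weighted_ip_ge0 k v : (forall x, 0 <= k x) -> 0 <= weighted_ip k v v.
Proof. by move=> k0; apply: torus_int_ge0 => x; rewrite mulr_ge0 ?dot_ge0. Qed.

Lemma weighted_ip_suml k n (a : 'rV[R]_n) (f : 'I_n -> dgv T l) w :
  bounded_measurable k ->
  weighted_ip k (\sum_i a 0 i *: f i) w = \sum_i a 0 i * weighted_ip k (f i) w.
Proof.
move=> bk; have wip0 : weighted_ip k 0 w = 0.
  have := weighted_ip_linearl 1 0 0 w bk; rewrite scale1r addr0 mul1r => e.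
  by apply: (addIr (weighted_ip k 0 w)); rewrite add0r -e.
apply: (big_rec2 (fun x y => weighted_ip k x w = y)) => // i y x _ <-.
by rewrite weighted_ip_linearl.
Qed.

Lemma weighted_ip_gram k n (a b : 'rV[R]_n) (f : 'I_n -> dgv T l) :
  bounded_measurable k ->
  weighted_ip k (\sum_i a 0 i *: f i) (\sum_i b 0 i *: f i) =
  (a *m (\matrix_(i, j) weighted_ip k (f i) (f j)) *m b^T) 0 0.
Proof.
move=> bk; rewrite weighted_ip_suml// -mulmxA mxE.
apply: eq_bigr => i _; congr (_ * _).
rewrite weighted_ipC weighted_ip_suml// mxE; apply: eq_bigr => j _.
by rewrite !mxE mulrC weighted_ipC.
Qed.

(** Some component of v is nonzero, and its square is bounded below by a positive
constant on a box of positive measure. *)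
Lemma ip_gt0 v : v != 0 -> 0 < ip v v.
Proof.
move=> v0; have [i vi] : exists i, dgv_comp v i != 0.
  apply/existsP; apply: contraNT v0 => /existsPn v0; apply/eqP.
  apply/ffunP => K; apply/ffunP => i; have := v0 i; rewrite negbK => /eqP.
  by move=> /ffunP/(_ K); rewrite !ffunE.
have [a [e [c [e0 c0 ae cv]]]] := dg_positive_box vi.
apply: (torus_int_gt0 (bounded_measurable_dot v v) _ e0 c0 ae) => [x|x ax].
  exact: dot_ge0.
rewrite (le_trans (cv x ax))// dot_dgv_fun (bigD1 i)//= expr2 lerDl.
by apply: sumr_ge0 => j _; rewrite -expr2 sqr_ge0.
Qed.

End weighted_forms.

Section mass_and_weighted_matrices.
Context {R : realType} {d l p n : nat} {T : mesh R d}.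
Variable f : n.-tuple (dgv T l).
Implicit Types (u w : dg T p).

Lemma bounded_measurable_pos_part u : bounded_measurable (pos_part_fun u).
Proof. exact/bounded_measurable_max0/bounded_measurable_dg_fun. Qed.

Lemma mass_mx_form (a b : 'rV[R]_n) :
  ip (\sum_i a 0 i *: tnth f i) (\sum_i b 0 i *: tnth f i) =
  (a *m mass_mx f *m b^T) 0 0.
Proof.
rewrite ip_weighted weighted_ip_gram; last exact: bounded_measurable_cst.
congr ((_ *m _ *m _) 0 0); apply/matrixP => i j; by rewrite !mxE ip_weighted.
Qed.

Lemma weighted_mx_form u (a b : 'rV[R]_n) :
  weighted_ip (pos_part_fun u)
    (\sum_i a 0 i *: tnth f i) (\sum_i b 0 i *: tnth f i) =
  (a *m weighted_mx f u *m b^T) 0 0.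
Proof. by rewrite weighted_ip_gram//; exact: bounded_measurable_pos_part. Qed.

Lemma mass_mx_sym : (mass_mx f)^T = mass_mx f.
Proof. by apply/matrixP => i j; rewrite !mxE !ip_weighted weighted_ipC. Qed.

Lemma mass_mx_unit : free f -> mass_mx f \in unitmx.
Proof.
move=> ff; rewrite -row_free_unit; apply/inj_row_free => a aM.
have /eqP v0 : \sum_i a 0 i *: tnth f i == 0.
  apply: contraT => /ip_gt0; rewrite mass_mx_form aM mul0mx mxE ltxx.
  by [].
apply/rowP => i; rewrite mxE; move/freeP : ff; apply.
by rewrite -[RHS]v0; apply: eq_bigr => j _; rewrite -tnth_nth.
Qed.

Lemma weighted_mx_psd u : sym_psd (weighted_mx f u).
Proof.
split; first by apply/matrixP => i j; rewrite !mxE; exact: weighted_ipC.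
move=> a; rewrite -weighted_mx_form; apply: weighted_ip_ge0 => x.
by rewrite /pos_part_fun le_max lexx orbT.
Qed.

Lemma gvecE u j : gvec f u j =
  \sum_i (col j (invmx (mass_mx f) *m psd_sqrt (weighted_mx f u)))^T 0 i
    *: tnth f i.
Proof. by apply: eq_bigr => i _; rewrite [in RHS]mxE [in RHS]mxE. Qed.

(** The factor M^-1 in the definition of the g_j cancels the mass matrix of the
inner product. *)
Lemma gvec_ip u j (b : 'rV[R]_n) : mass_mx f \in unitmx ->
  ip (gvec f u j) (\sum_i b 0 i *: tnth f i) =
  (psd_sqrt (weighted_mx f u) *m b^T) j 0.
Proof.
move=> Mu; rewrite gvecE mass_mx_form; set S := psd_sqrt _.
have [[Ss _] _] := psd_sqrtP (weighted_mx_psd u); rewrite -/S in Ss.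
rewrite colE !trmx_mul Ss trmx_inv mass_mx_sym -!mulmxA (mulmxA (invmx _)).
by rewrite mulVmx// mul1mx trmx_delta -rowE mxE.
Qed.

Lemma sum_gvec_ip u (a b : 'rV[R]_n) : mass_mx f \in unitmx ->
  \sum_j ip (gvec f u j) (\sum_i a 0 i *: tnth f i) *
         ip (gvec f u j) (\sum_i b 0 i *: tnth f i) =
  weighted_ip (pos_part_fun u)
    (\sum_i a 0 i *: tnth f i) (\sum_i b 0 i *: tnth f i).
Proof.
move=> Mu; rewrite weighted_mx_form.
have [[Ss _] SS] := psd_sqrtP (weighted_mx_psd u).
rewrite -[in RHS]SS mulmxA -mulmxA mxE; apply: eq_bigr => j _.
rewrite !gvec_ip//; congr (_ * _).
by rewrite -[in LHS]Ss -trmx_mul mxE.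
Qed.

(** Of the two factors M^-1 in the difference of the g_j, one cancels the mass
matrix of the inner product. *)
Lemma gvec_sub_ip u w j : mass_mx f \in unitmx ->
  let D := psd_sqrt (weighted_mx f w) - psd_sqrt (weighted_mx f u) in
  ip (gvec f w j - gvec f u j) (gvec f w j - gvec f u j) =
  (D *m invmx (mass_mx f) *m D) j j.
Proof.
move=> Mu D.
have [[Sws _] _] := psd_sqrtP (weighted_mx_psd w).
have [[Sus _] _] := psd_sqrtP (weighted_mx_psd u).
have Ds : D^T = D by rewrite linearB /= Sws Sus.
have -> : gvec f w j - gvec f u j =
    \sum_i (col j (invmx (mass_mx f) *m D))^T 0 i *: tnth f i.
  rewrite !gvecE -sumrB; apply: eq_bigr => i _.
  by rewrite -scalerBl mulmxBr; congr (_ *: _); rewrite ![in RHS]mxE !mxE.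
rewrite mass_mx_form trmxK colE !trmx_mul Ds trmx_inv mass_mx_sym.
rewrite -!mulmxA (mulmxA (mass_mx f)) mulmxV// mul1mx trmx_delta -rowE.
by rewrite !mulmxA -colE mxE [LHS]mxE.
Qed.

End mass_and_weighted_matrices.

(** * Continuity *)

Section continuity.
Context {R : realType} {d l p n : nat} {T : mesh R d}.
Variable f : n.-tuple (dgv T l).
Implicit Types (u w : dg T p).

(** Young's inequality |h| <= h^2 / (2 delta) + delta / 2, integrated over the
torus, whose measure is 1. *)
Lemma torus_int_norm_le (h : 'rV[R]_d -> R) delta : bounded_measurable h ->
  0 < delta -> Num.sqrt (torus_int (fun x => h x ^+ 2)) < delta ->
  torus_int (fun x => `|h x|) <= delta.
Proof.
move=> bh d0 hd.
have bh2 : bounded_measurable (fun x => h x ^+ 2).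
  by under eq_fun do rewrite expr2; exact: bounded_measurableM.
have hd2 : torus_int (fun x => h x ^+ 2) <= delta ^+ 2.
  rewrite -[leLHS]sqr_sqrtr; last by apply: torus_int_ge0 => x; rewrite sqr_ge0.
  by rewrite lerXn2r ?nnegrE ?sqrtr_ge0 1?ltW.
have young x : `|h x| <= (2 * delta)^-1 * h x ^+ 2 + delta / 2.
  have dd : 2 * delta != 0 by rewrite mulf_neq0 ?gt_eqF.
  rewrite -subr_ge0 -real_normK ?num_real//.
  rewrite (_ : _ - _ = (2 * delta)^-1 * (`|h x| - delta) ^+ 2).
    by rewrite mulr_ge0 ?sqr_ge0// invr_ge0 mulr_ge0 ?ler0n// ltW.
  by field; rewrite gt_eqF.
apply: (le_trans (le_torus_int (bounded_measurable_norm bh) _ young)).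
  apply: bounded_measurableD; first exact: bounded_measurableZ.
  exact: bounded_measurable_cst.
rewrite torus_intD; [|exact: bounded_measurableZ|exact: bounded_measurable_cst].
rewrite torus_intZ// torus_int_cst.
have dE : (2 * delta)^-1 * delta ^+ 2 + delta / 2 = delta.
  by field; rewrite gt_eqF.
rewrite -[leRHS]dE lerD2r ler_wpM2l// invr_ge0 mulr_ge0 ?ler0n//; exact: ltW.
Qed.

(** The positive part is 1-Lipschitz and the pointwise products of the fields in
f are bounded. *)
Lemma weighted_mx_lipschitz : exists2 B, 0 <= B & forall u w i j,
  `|(weighted_mx f w - weighted_mx f u) i j| <=
  B * torus_int (fun x => `|dg_fun (w - u) x|).
Proof.
have /boolp.choice[B fB] : forall ij : 'I_n * 'I_n, exists b : R, forall x,
    `|dot (dgv_fun (tnth f ij.1) x) (dgv_fun (tnth f ij.2) x)| <= b.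
  by move=> ij; have [_] := bounded_measurable_dot (tnth f ij.1) (tnth f ij.2).
have B0 ij : 0 <= B ij by exact: le_trans (fB ij 0).
exists (\sum_ij B ij) => [|u w i j]; first exact: sumr_ge0.
pose g x := dot (dgv_fun (tnth f i) x) (dgv_fun (tnth f j) x).
have bg : bounded_measurable g by exact: bounded_measurable_dot.
have bh : bounded_measurable (dg_fun (w - u)) by exact: bounded_measurable_dg_fun.
have bk v : bounded_measurable (fun x => pos_part_fun v x * g x).
  exact: bounded_measurableM (bounded_measurable_pos_part v) bg.
have -> : (weighted_mx f w - weighted_mx f u) i j =
    torus_int (fun x => (pos_part_fun w x - pos_part_fun u x) * g x).
  rewrite !mxE -mulN1r -torus_intZ// -torus_intD//;
    last exact: bounded_measurableZ.
  by congr torus_int; apply/funext => x; rewrite /g; ring.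
have bD :
    bounded_measurable (fun x => (pos_part_fun w x - pos_part_fun u x) * g x).
  under eq_fun do rewrite mulrBl -mulN1r.
  by apply: bounded_measurableD => //; exact: bounded_measurableZ.
have bN : bounded_measurable (fun x => `|dg_fun (w - u) x|).
  exact: bounded_measurable_norm.
rewrite (le_trans (le_norm_torus_int bD))// -torus_intZ//.
apply: le_torus_int => [||x].
- exact: bounded_measurable_norm.
- exact: bounded_measurableZ.
rewrite normrM mulrC ler_pM//.
  rewrite (le_trans (fB (i, j) x))// (bigD1 (i, j))//= lerDl.
  exact: sumr_ge0.
have -> : dg_fun (w - u) x = dg_fun w x - dg_fun u x.
  by rewrite addrC -scaleN1r dg_fun_linear mulN1r addrC.
rewrite /pos_part_fun.
case: (lerP (dg_fun w x) 0); case: (lerP (dg_fun u x) 0) => a b;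
  rewrite ?subrr ?normr0// ?sub0r ?subr0 ?normrN.
- by rewrite gtr0_norm// ltr0_norm; lra.
- by rewrite gtr0_norm// gtr0_norm; lra.
Qed.

(** When the L^2 distance of w to u is less than delta, the weighted matrices
differ entrywise by at most B delta, hence their square roots by at most
n^2 sqrt(B delta), and the squared distance of the g_j is at most C delta, with
C depending on M^-1. *)
Lemma gvec_continuous j u (eps : R) : mass_mx f \in unitmx -> 0 < eps ->
  exists2 delta, 0 < delta & forall w,
    L2norm (w - u) < delta -> L2normv (gvec f w j - gvec f u j) < eps.
Proof.
move=> Mu eps0; have [B B0 WB] := weighted_mx_lipschitz.
pose V := invmx (mass_mx f); pose C := n%:R ^+ 4 * B * \sum_k \sum_m `|V k m|.
have C0 : 0 <= C.
  by rewrite mulr_ge0// ?mulr_ge0 ?exprn_ge0// sumr_ge0// => k _; exact: sumr_ge0.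
(* C delta < eps ^+ 2, also when C = 0. *)
pose delta := eps ^+ 2 / (C + 1).
have d0 : 0 < delta by rewrite divr_gt0 ?exprn_gt0 ?ltr_wpDl.
exists delta => // w wu.
have h1 := torus_int_norm_le (bounded_measurable_dg_fun (w - u)) d0 wu.
have psdu := psd_sqrtP (weighted_mx_psd f u).
have psdw := psd_sqrtP (weighted_mx_psd f w).
set Su := psd_sqrt _ in psdu; set Sw := psd_sqrt _ in psdw.
have holder i k : `|(Sw - Su) i k| <= n%:R ^+ 2 * Num.sqrt (B * delta).
  apply: psd_sqrt_holder; [exact: psdw.1|exact: psdu.1|].
  by move=> a b; rewrite psdw.2 psdu.2 (le_trans (WB _ _ _ _))// ler_wpM2l.
have Bd : 0 <= B * delta by rewrite mulr_ge0// ltW.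
rewrite /L2normv -[ltRHS]ger0_norm ?ltW// -sqrtr_sqr ltr_sqrt ?exprn_gt0//.
rewrite gvec_sub_ip// -/Su -/Sw.
apply: (@le_lt_trans _ _ (C * delta)); last first.
  have C1 : 0 < C + 1 by rewrite ltr_wpDl.
  by rewrite /delta mulrCA gtr_pMr ?exprn_gt0// ltr_pdivrMr// mul1r ltrDl.
rewrite (le_trans (ler_norm _))// mxE (le_trans (ler_norm_sum _ _ _))//.
have -> : C * delta = \sum_m \sum_k n%:R ^+ 4 * (B * delta) * `|V k m|.
  rewrite exchange_big /= /C; under eq_bigr do rewrite -mulr_sumr.
  by rewrite -mulr_sumr mulrAC !mulrA.
apply: ler_sum => m _; rewrite mxE normrM.
rewrite (le_trans (ler_wpM2r (normr_ge0 _) (ler_norm_sum _ _ _)))//.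
rewrite mulr_suml; apply: ler_sum => k _; rewrite normrM -/V mulrAC.
rewrite ler_wpM2r//.
have -> : n%:R ^+ 4 * (B * delta) =
    (n%:R ^+ 2 * Num.sqrt (B * delta)) * (n%:R ^+ 2 * Num.sqrt (B * delta)).
  by rewrite -[in LHS](sqr_sqrtr Bd); ring.
by rewrite ler_pM.
Qed.

End continuity.

(** * Existence, formula and continuity of the functions g_j *)

Theorem proposition4p1 (R : realType) (d p : nat) (hd : (1 <= d <= 3)%N)
    (hp : (1 <= p)%N) (T : mesh R d) (sigma c : R)
    (hT : shape_regular T sigma) (hTq : quasi_uniform T c)
    (f : (\dim {: dgv T p.-1}).-tuple (dgv T p.-1))
    (hf : basis_of {: dgv T p.-1} f) :
  mass_mx f \in unitmx /\
  (forall u : dg T p,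
    [/\ sym_psd (weighted_mx f u),
        exists! S, is_psd_sqrt (weighted_mx f u) S &
        forall v1 v2 : dg T p,
          \sum_j ip (gvec f u j) (dgrad v1) * ip (gvec f u j) (dgrad v2) =
          torus_int (fun x => pos_part_fun u x *
            dot (dgv_fun (dgrad v1) x) (dgv_fun (dgrad v2) x))]) /\
  (forall j (u : dg T p) (eps : R), 0 < eps ->
    exists2 delta, 0 < delta & forall w : dg T p,
      L2norm (w - u) < delta -> L2normv (gvec f w j - gvec f u j) < eps).
Proof.
have Mu : mass_mx f \in unitmx by apply: mass_mx_unit; exact: basis_free hf.
split=> //; split=> [u|j u eps]; last exact: gvec_continuous.
have psd := weighted_mx_psd f u; split=> // [|v1 v2].
  exists (psd_sqrt (weighted_mx f u)); split; first exact: psd_sqrtP.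
  by move=> S; apply: psd_sqrt_unique; exact: psd_sqrtP.
have fE (v : dgv T p.-1) : exists a : 'rV[R]_(\dim {: dgv T p.-1}),
    v = \sum_i a 0 i *: tnth f i.
  exists (\row_i coord f i v); rewrite [LHS](coord_basis hf (memvf v)).
  by apply: eq_bigr => i _; rewrite mxE -tnth_nth.
have [a ->] := fE (dgrad v1); have [b ->] := fE (dgrad v2).
exact: sum_gvec_ip.
Qed.
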